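(* Let $\mathfrak{M}=(\mathbf{M},\models,\mathcal{P}(\mathscr{L}))$ be a normal abstract model structure such that $\mathscr{L}$ is not finitely satisfiable, and let $\vdash_{\mathfrak{M}}$ be its induced relation. The following are equivalent: (1) $\mathfrak{M}$ is compact. (2) Every finitely satisfiable set is contained in a $\vdash_{\mathfrak{M}}$-nontrivial maximal finitely satisfiable set. (3) Every finitely satisfiable set is contained in a maximal satisfiable set. (4) Every finitely satisfiable set is contained in a complete set. (5) Every $\vdash_{\mathfrak{M}}$-trivial set has a finite $\vdash_{\mathfrak{M}}$-trivial subset. (6) For every nonempty set $I$ and every $f:I\to\mathcal{P}(\mathscr{L})$ such that $(f(I),\subseteq)$ is directed (for all $i,j\in I$ there is $k\in I$ with $f(i)\cup f(j)\subseteq f(k)$): if $f(i)$ is satisfiable for all $i\in I$, then $\bigcup_{i\in I}f(i)$ is satisfiable. (7) For every $\Sigma\subseteq\mathscr{L}$ and every map $f:\mathsf{FinSet}(\Sigma)\to\mathcal{P}(\mathscr{L})$ that is order-preserving with respect to $\subseteq$ on both sides: if $f(\Gamma)$ is satisfiable for all $\Gamma\in\mathsf{FinSet}(\Sigma)$, then $\bigcup_{\Gamma\in\mathsf{FinSet}(\Sigma)}f(\Gamma)$ is satisfiable. (8) For every nonempty set $I$ and every $f:I\to\mathcal{P}(\mathbf{M})$ such that $(f(I),\supseteq)$ is directed (for all $i,j\in I$ there is $k\in I$ with $f(k)\subseteq f(i)\cap f(j)$): if $f(i)\neq\emptyset$ for all $i\in I$, then $\bigcup_{i\in I}\mathsf{Th}(f(i))$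 is satisfiable. (9) For every finitely satisfiable $\Sigma\subseteq\mathscr{L}$ and every map $f:\mathsf{FinSet}(\Sigma)\to\mathcal{P}(\mathbf{M})$ that is order-reversing with respect to $\subseteq$ (i.e. $\Gamma\subseteq\Gamma'$ implies $f(\Gamma')\subseteq f(\Gamma)$): if $f(\Gamma)\neq\emptyset$ for all $\Gamma\in\mathsf{FinSet}(\Sigma)$, then $\bigcup_{\Gamma\in\mathsf{FinSet}(\Sigma)}\mathsf{Th}(f(\Gamma))$ is satisfiable.
   Context: An abstract model structure is a triple $(\mathbf{M},\models,\mathcal{P}(\mathscr{L}))$ with $\mathbf{M}\neq\emptyset$, $\mathscr{L}$ a set and $\models\,\subseteq\mathbf{M}\times\mathcal{P}(\mathscr{L})$. It is normal if for all $m$ and $\Gamma$: $m\models\Gamma$ iff $m\models\{\alpha\}$ for all $\alpha\in\Gamma$. $\mathsf{Mod}(\Gamma)=\{m\in\mathbf{M}\mid m\models\Gamma\}$; $\mathsf{Th}(X)=\{\alpha\in\mathscr{L}\mid m\models\{\alpha\}\text{ for all }m\in X\}$ for $X\subseteq\mathbf{M}$. $\Gamma$ is satisfiable if $\mathsf{Mod}(\Gamma)\neq\emptyset$; finitely satisfiable if every finite subset is satisfiable; maximal (finitely) satisfiable if (finitely) satisfiable and no proper superset in $\mathscr{L}$ is (finitely) satisfiable. $\mathfrak{M}$ is compact if every finitely satisfiable $\Gamma\subseteq\mathscr{L}$ is satisfiable (and conversely). $\Gamma$ is complete if $\mathsf{Mod}(\Gamma)\ne\emptyset$ and for every $\alpha\in\mathscr{L}$,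 either $\mathsf{Mod}(\Gamma)\subseteq\mathsf{Mod}(\{\alpha\})$ or $\mathsf{Mod}(\Gamma)\subseteq\mathbf{M}\setminus\mathsf{Mod}(\{\alpha\})$. $\Gamma\vdash_{\mathfrak{M}}\alpha$ iff $\mathsf{Mod}(\Gamma)\subseteq\mathsf{Mod}(\{\alpha\})$; $\Gamma$ is $\vdash_{\mathfrak{M}}$-trivial if $\Gamma\vdash_{\mathfrak{M}}\beta$ for all $\beta\in\mathscr{L}$, nontrivial otherwise. $\mathsf{FinSet}(A)$ is the set of finite subsets of $A$. *)

(* Defs.v *)
From mathcomp Require Import all_boot.
From mathcomp Require Import boolp classical_sets cardinality.
Set Implicit Arguments.
Unset Strict Implicit.
Unset Printing Implicit Defensive.
Local Open Scope classical_set_scope.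

Record model_structure := ModelStructure {
  model : Type;
  sentence : Type;
  models : model -> set sentence -> Prop;
  model_nonempty : [set: model] !=set0
}.

Definition normal_structure (S : model_structure) : Prop :=
  forall (m : model S) (G : set (sentence S)),
    models m G <-> (forall a, G a -> models m [set a]).

Definition Mod (S : model_structure) (G : set (sentence S)) : set (model S) :=
  [set m | models m G].

Definition Th (S : model_structure) (X : set (model S)) : set (sentence S) :=
  [set a | forall m, X m -> models m [set a]].

Definition finite_subsets (T : Type) (A : set T) : set (set T) :=
  [set G | finite_set G /\ G `<=` A].

Definition satisfiable (S : model_structure) (G : set (sentence S)) : Prop :=
  Mod G !=set0.

Definition finitely_satisfiable (S : model_structure) (G : set (sentence S)) :
    Prop :=
  forall D, finite_subsets G D -> satisfiable D.

Definition maximal_satisfiable (S : model_structure) (G : set (sentence S)) :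
    Prop :=
  satisfiable G /\ forall D, G `<` D -> ~ satisfiable D.

Definition maximal_finitely_satisfiable (S : model_structure)
    (G : set (sentence S)) : Prop :=
  finitely_satisfiable G /\ forall D, G `<` D -> ~ finitely_satisfiable D.

Definition compact_structure (S : model_structure) : Prop :=
  forall G : set (sentence S), finitely_satisfiable G <-> satisfiable G.

Definition complete_set (S : model_structure) (G : set (sentence S)) : Prop :=
  Mod G !=set0 /\
  forall a, Mod G `<=` Mod [set a] \/ Mod G `<=` ~` Mod [set a].

Definition entails (S : model_structure) (G : set (sentence S))
    (a : sentence S) : Prop :=
  Mod G `<=` Mod [set a].

Definition trivial_set (S : model_structure) (G : set (sentence S)) : Prop :=
  forall b, entails G b.

(* Main.v *)
(* A maximal finitely satisfiable extension always exists by Zorn's lemma, so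
   compactness amounts to its having a model; and since the set of all
   sentences has no model, a set is trivial exactly when it is unsatisfiable,
   which makes (5) the contrapositive of compactness. The directed-union
   conditions follow because a finite subset of a directed union lies in one of
   its members; conversely a finitely satisfiable set is contained in the
   directed union of the theories of the model classes of its finite subsets. *)
Require Import Defs.
From mathcomp Require Import all_boot.
From mathcomp Require Import boolp classical_sets cardinality.
Set Implicit Arguments.
Unset Strict Implicit.
Unset Printing Implicit Defensive.
Local Open Scope classical_set_scope.

Lemma finite_subsets_set0 (T : Type) (A : set T) : finite_subsets A set0.
Proof. by split; [exact: finite_set0|exact: sub0set]. Qed.

Lemma finite_subsets_setU (T : Type) (A G H : set T) :
  finite_subsets A G -> finite_subsets A H -> finite_subsets A (G `|` H).
Proof.
by move=> [finG GA] [finH HA]; split; [rewrite finite_setU|rewrite subUset].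
Qed.

Lemma finite_subsets_set1 (T : Type) (A : set T) (a : T) :
  A a -> finite_subsets A [set a].
Proof. by move=> Aa; split=> [|b ->//]; exact: finite_set1. Qed.

Lemma finite_subsets_inhabited (T : Type) (A : set T) :
  inhabited (finite_subsets A).
Proof. exact: inhabits (SigSub (mem_set (finite_subsets_set0 A))). Qed.

Lemma finite_subsets_directed (T : Type) (A : set T) (G H : finite_subsets A) :
  exists K : finite_subsets A, sval G `<=` sval K /\ sval H `<=` sval K.
Proof.
exists (SigSub (mem_set (finite_subsets_setU (set_valP G) (set_valP H)))).
by split; [exact: subsetUl|exact: subsetUr].
Qed.

Lemma bigcup_finite_subsets (T : Type) (A : set T) :
  \bigcup_(G : finite_subsets A) sval G = A.
Proof.
apply/seteqP; split=> [a [G _]|a Aa]; first by have [_] := set_valP G; exact.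
by exists (SigSub (mem_set (finite_subsets_set1 Aa))).
Qed.

(** Induction on an enumeration of [D]: directedness merges a member covering the earlier elements
    with one containing the new element, and nonemptiness of [J] serves the empty [D]. *)
Lemma finite_sub_directed_bigcup (T I : Type) (J : set I) (f : I -> set T)
    (D : set T) :
  J !=set0 ->
  (forall i j, J i -> J j -> exists2 k, J k & f i `|` f j `<=` f k) ->
  finite_set D -> D `<=` \bigcup_(i in J) f i ->
  exists2 k, J k & D `<=` f k.
Proof.
move=> [i0 Ji0] dirf finD.
(* Classically [T] is a choice type, so [D] can be listed as a sequence. *)
elim/Pchoice: T => T in f dirf D finD *.
case/finite_seqP: finD => s ->.
elim: s => [|x s IH] sub; first by exists i0 => // y.
have [y /= ys|i Ji subi] := IH; first by apply: sub; rewrite /= inE ys orbT.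
have [|j Jj fjx] := sub x; first by rewrite /= inE eqxx.
have [k Jk ijk] := dirf i j Ji Jj; exists k => // y /=.
rewrite inE => /orP[/eqP ->|ys]; apply: ijk; first by right.
by left; exact: subi.
Qed.

Lemma nonsatisfiable_trivial (S : model_structure) (G : set (sentence S)) :
  ~ satisfiable G -> trivial_set G.
Proof. by move=> nG b m Gm; case: nG; exists m. Qed.

(** Zorn's lemma is applied to the sets [X] whose union with [G] is finitely satisfiable, not to
    extensions of [G], because the union of the empty chain is empty and need not contain [G]. *)
Lemma finitely_satisfiable_maximal (S : model_structure)
    (G : set (sentence S)) :
  finitely_satisfiable G ->
  exists D, G `<=` D /\ maximal_finitely_satisfiable D.
Proof.
move=> fsG.
have [|A [fsA maxA]] := @Zorn_bigcup _ [set X | finitely_satisfiable (G `|` X)].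
  move=> F FP totF D [finD DU] /=.
  (* [set0] is added to the chain so that it is nonempty. *)
  have [||//||X FX DX] := @finite_sub_directed_bigcup _ _ (set0 |` F) (setU G) D.
  - by exists set0; left.
  - move=> X Y [->|FX] [->|FY].
    + by exists set0; [left|rewrite setUid].
    + by exists Y; [right|rewrite setU0 => a [Ga|//]; left].
    + by exists X; [right|rewrite setU0 => a [//|Ga]; left].
    + have [XY|YX] := totF X Y FX FY.
      * by exists Y; [right|rewrite subUset; split=> //; exact: setUS].
      * by exists X; [right|rewrite subUset; split=> //; exact: setUS].
  - move=> a /DU[Ga|[X FX Xa]]; first by exists set0; left.
    by exists X; right.
  - case: FX DX => [->|FX] DX; last exact: (FP X FX D).
    by apply: fsG; split=> //; rewrite setU0 in DX.
exists (G `|` A); split; first exact: subsetUl.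
(* Such a [B] properly contains [A] and absorbs [G], so its finite satisfiability contradicts the
   maximality of [A]. *)
split=> // B [GAB nBGA] fsB; apply: (maxA B).
  split; first by move=> a Aa; apply: GAB; right.
  by move=> BA; apply: nBGA => a /BA Aa; right.
by rewrite /= (setUidr (subset_trans _ GAB)).
Qed.

Section NormalStructure.
Context (S : model_structure) (normalS : normal_structure S).
Implicit Types G D : set (sentence S).

Lemma sub_Mod G D : G `<=` D -> Mod D `<=` Mod G.
Proof. by move=> GD m /normalS mD; apply/normalS => a /GD/mD. Qed.

Lemma satisfiable_sub G D : G `<=` D -> satisfiable D -> satisfiable G.
Proof. by move=> GD [m mD]; exists m; exact: sub_Mod mD. Qed.

Lemma satisfiable_finitely G : satisfiable G -> finitely_satisfiable G.
Proof. by move=> satG D [_ DG]; exact: satisfiable_sub satG. Qed.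

Lemma satisfiable_Th (X : set (model S)) : X !=set0 -> satisfiable (Th X).
Proof. by move=> [m Xm]; exists m; apply/normalS => a; exact. Qed.

(** A sentence outside [G] that holds in some model of [G] could be added without losing
    satisfiability, against maximality. *)
Lemma maximal_satisfiable_complete G : maximal_satisfiable G -> complete_set G.
Proof.
move=> [satG maxG]; split=> // a.
have [Ga|nGa] := pselect (G a); first by left; apply: sub_Mod => b ->.
right=> m mG ma; apply: (maxG (a |` G)).
  by split; [exact: subsetUr|move=> sub; apply: nGa; apply: sub; left].
by exists m; apply/normalS => b [->//|]; move/normalS: mG; exact.
Qed.

Hypothesis nfsat : ~ finitely_satisfiable [set: sentence S].

Lemma trivial_nonsatisfiable G : trivial_set G -> ~ satisfiable G.
Proof.
move=> trivG [m mG]; apply: nfsat; apply: satisfiable_finitely; exists m.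
by apply/normalS => a _; exact: trivG.
Qed.

End NormalStructure.

Theorem theorem3p14 (S : model_structure) (normalS : normal_structure S)
    (nfsat : ~ finitely_satisfiable [set: sentence S]) :
  [<-> (* 1 *) compact_structure S;
       (* 2 *) forall G : set (sentence S), finitely_satisfiable G ->
         exists D : set (sentence S),
           [/\ G `<=` D, ~ trivial_set D & maximal_finitely_satisfiable D];
       (* 3 *) forall G : set (sentence S), finitely_satisfiable G ->
         exists D : set (sentence S), G `<=` D /\ maximal_satisfiable D;
       (* 4 *) forall G : set (sentence S), finitely_satisfiable G ->
         exists D : set (sentence S), G `<=` D /\ complete_set D;
       (* 5 *) forall G : set (sentence S), trivial_set G ->
         exists D : set (sentence S), finite_subsets G D /\ trivial_set D;
       (* 6 *) forall (I : Type) (f : I -> set (sentence S)),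
         inhabited I ->
         (forall i j, exists k, f i `|` f j `<=` f k) ->
         (forall i, satisfiable (f i)) ->
         satisfiable (\bigcup_i f i);
       (* 7 *) forall (A : set (sentence S))
           (f : finite_subsets A -> set (sentence S)),
         (forall G H : finite_subsets A, sval G `<=` sval H -> f G `<=` f H) ->
         (forall G, satisfiable (f G)) ->
         satisfiable (\bigcup_G f G);
       (* 8 *) forall (I : Type) (f : I -> set (model S)),
         inhabited I ->
         (forall i j, exists k, f k `<=` f i `&` f j) ->
         (forall i, f i !=set0) ->
         satisfiable (\bigcup_i Th (f i));
       (* 9 *) forall (A : set (sentence S))
           (f : finite_subsets A -> set (model S)),
         finitely_satisfiable A ->
         (forall G H : finite_subsets A, sval G `<=` sval H -> f H `<=` f G) ->
         (forall G, f G !=set0) ->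
         satisfiable (\bigcup_G Th (f G))].
Proof.
tfae.
- move=> comp G /finitely_satisfiable_maximal[D [GD maxD]].
  exists D; split=> // /(trivial_nonsatisfiable normalS nfsat); apply.
  by apply/comp; case: maxD.
(* A nontrivial set has a model, and satisfiable extensions are finitely satisfiable, so maximality
   carries over. *)
- move=> maxfs G /maxfs[D [GD ntD [_ maxD]]]; exists D; split=> //.
  split=> [|E /maxD nE /(satisfiable_finitely normalS)//].
  by apply: contrapT => /nonsatisfiable_trivial.
- move=> maxs G /maxs[D [GD maxD]]; exists D; split=> //.
  exact: maximal_satisfiable_complete.
- move=> compl G trivG; apply: contrapT => nfin.
  have [|D [GD [satD _]]] := compl G.
    by move=> D GD; apply: contrapT => /nonsatisfiable_trivial ?; case: nfin; exists D.
  exact: (trivial_nonsatisfiable normalS nfsat trivG (satisfiable_sub normalS GD satD)).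
- move=> fintriv I f [i0] dirf satf; apply: contrapT => /nonsatisfiable_trivial.
  move=> /fintriv[D [[finD DU] trivD]].
  have [||k _ Dk] := finite_sub_directed_bigcup _ _ finD DU; first by exists i0.
    by move=> i j _ _; have [k] := dirf i j; exists k.
  apply: (trivial_nonsatisfiable normalS nfsat trivD).
  exact: satisfiable_sub Dk (satf k).
- move=> dirsat A f monof; apply: dirsat; first exact: finite_subsets_inhabited.
  move=> G H; have [K [GK HK]] := finite_subsets_directed G H.
  by exists K; rewrite subUset; split; exact: monof.
- move=> monosat I f [i0] dirf f0; set U := \bigcup_i _.
  (* The monotone map is the inclusion of the finite subsets of [U]; each of them lies in a single
     [Th (f k)], which has a model because [f k] is nonempty. *)
  rewrite -(bigcup_finite_subsets U).
  apply: monosat => // -[G /= /set_mem[finG GU]].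
  have [||k _ Gk] := finite_sub_directed_bigcup _ _ finG GU; first by exists i0.
    (* [Th] reverses inclusions, so the theories are directed upwards. *)
    move=> i j _ _; have [k kij] := dirf i j; exists k => //.
    by rewrite subUset; split=> a ma m /kij[? ?]; exact: ma.
  exact: satisfiable_sub Gk (satisfiable_Th normalS (f0 k)).
- move=> dirsat A f _ antif; apply: dirsat; first exact: finite_subsets_inhabited.
  move=> G H; have [K [GK HK]] := finite_subsets_directed G H.
  by exists K; rewrite subsetI; split; exact: antif.
- move=> antisat G; split=> [fsG|]; last exact: satisfiable_finitely.
  have := @antisat G (fun D => Mod (sval D)) fsG.
  move=> /(_ (fun D E => sub_Mod normalS (D := sval E)))[|m mU].
    by move=> [D /= /set_mem]; exact: fsG.
  exists m; apply: (sub_Mod normalS) mU.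
  (* By normality, a sentence of a finite subset holds in all models of that subset, hence lies in
     the theory of its model class. *)
  rewrite -{1}(bigcup_finite_subsets G) => a [D _ Da].
  by exists D => // n /normalS; exact.
Qed.
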